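(* Let $G$ be a finite abelian group, let $H$ be a subgroup of $G$, let $\widehat{G}_{H} := \{ \chi \in \widehat{G} \mid \chi(h) = 1 \text{ for all } h \in H \}$, let $T \subset G$ be a complete set of representatives of the cosets of $H$ in $G$ (so $G = \bigsqcup_{t \in T} tH$), and let $X \subset \widehat{G}$ be a complete set of representatives of the cosets of $\widehat{G}_{H}$ in $\widehat{G}$ (so $\widehat{G} = \bigsqcup_{\chi \in X} \chi \widehat{G}_{H}$). For $\chi \in X$, $t \in T$ and $h \in H$ put $$ y_{tH}^{\chi} := \sum_{h' \in H} \chi(th')\, x_{th'}, \qquad z_{h} := \frac{1}{|H|} \sum_{\chi \in X} \chi(h^{-1})\, \Theta_{G/H}\left( y_{tH}^{\chi} \right). $$ Then $$ \Theta_{G}(x_{g}) = \prod_{\chi \in X} \Theta_{G/H}\left( y_{tH}^{\chi} \right) = \Theta_{H}(z_{h}). $$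
   Context: For a finite group $G$, let $x_g$ ($g \in G$) be independent commuting indeterminates. The group determinant of $G$ is $\Theta_G(x_g) := \det\left( x_{gh^{-1}} \right)_{g,h \in G} \in \mathbb{Z}[x_g]$, where $\mathbb{Z}[x_g]$ is the polynomial ring over $\mathbb{Z}$ in all the variables $x_g$, $g\in G$; it does not depend on the ordering of the elements of $G$. If $K$ is a finite group and $(w_k)_{k \in K}$ is a family of elements of a commutative ring, $\Theta_K(w_k)$ denotes the determinant of $(w_{kl^{-1}})_{k,l \in K}$. In particular $\Theta_{G/H}(y_{tH}^{\chi})$ (for fixed $\chi$) is the group determinant of $G/H$ with the variable indexed by the coset $tH$ replaced by $y_{tH}^{\chi} \in \mathbb{C}[x_g]$, and $\Theta_H(z_h)$ is the group determinant of $H$ with the variable indexed by $h\in H$ replaced by $z_h \in \mathbb{C}[x_g]$. For a finite abelian group $G$, $\widehat{G}$ denotes the group of characters (homomorphisms) $G \to \mathbb{C}^{\times}$. *)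

(* Defs.v *)
From HB Require Import structures.
From mathcomp Require Import all_boot all_order all_algebra all_fingroup.
From mathcomp Require Import cyclic complex mpoly reals.

Set Implicit Arguments.
Unset Strict Implicit.
Unset Printing Implicit Defensive.

Import GRing.Theory.
Local Open Scope ring_scope.

(* The rows and columns of the matrix are indexed by 'I_#|K| through the
   enumeration enum_val of K. *)
Definition group_det (gT : finGroupType) (K : {group gT}) (A : comNzRingType)
    (w : gT -> A) : A :=
  \det (\matrix_(i < #|K|, j < #|K|) w (enum_val i * (enum_val j)^-1)%g).

Definition group_var (A : nzRingType) (gT : finGroupType) (g : gT) :
  {mpoly A[#|gT|]} := 'X_(enum_rank g).

Arguments group_var A {gT} g.

Section Dual.
Variables (C : numClosedFieldType) (gT : finGroupType).
Implicit Types f : {ffun gT -> C}.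

(* f is a group homomorphism from gT to the multiplicative group of C. *)
Definition is_char f : bool :=
  [forall x, f x != 0] && [forall x, forall y, f (x * y)%g == f x * f y].

Record dual := Dual { dual_fun :> {ffun gT -> C}; dual_is_char : is_char dual_fun }.

HB.instance Definition _ := [isSub for dual_fun].
HB.instance Definition _ := [Choice of dual by <:].

Lemma is_charP f :
  reflect ((forall x, f x != 0) /\ (forall x y, f (x * y)%g = f x * f y))
          (is_char f).
Proof.
apply: (iffP andP) => -[f0 fM]; split.
- exact/forallP.
- by move=> x y; apply/eqP; move/forallP/(_ x)/forallP: fM.
- exact/forallP.
- by apply/forallP=> x; apply/forallP=> y; rewrite fM.
Qed.

Lemma dual_neq0 (chi : dual) x : chi x != 0.
Proof. by case/is_charP: (dual_is_char chi). Qed.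

Lemma dualM (chi : dual) x y : chi (x * y)%g = chi x * chi y.
Proof. by case/is_charP: (dual_is_char chi). Qed.

Lemma dual1 (chi : dual) : chi 1%g = 1.
Proof. by apply: (mulfI (dual_neq0 chi 1%g)); rewrite -dualM mulg1 mulr1. Qed.

Lemma dualX (chi : dual) x n : chi (x ^+ n)%g = chi x ^+ n.
Proof. by elim: n => [|n IHn]; rewrite ?dual1 // expgS dualM IHn exprS. Qed.

(* dual is finite: its members take values in the #|gT|-th roots of unity. *)
Let unity_roots : seq C :=
  sval (closed_field_poly_normal ('X^#|gT| - 1 : {poly C})).

Lemma dual_unity_root (chi : dual) x : chi x \in unity_roots.
Proof.
rewrite /unity_roots; case: closed_field_poly_normal => r /= Er.
have n_gt0 : (0 < #|gT|)%N by apply/card_gt0P; exists x.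
rewrite -root_prod_XsubC.
have <- : 'X^#|gT| - 1 = \prod_(z <- r) ('X - z%:P) :> {poly C}.
  by rewrite Er (monicP (monicXnsubC _ n_gt0)) scale1r.
rewrite rootE !hornerE -dualX -cardsT.
have -> : (x ^+ #|[set: gT]| = 1)%g.
  exact: expg_cardG (in_setT x).
by rewrite dual1 subrr.
Qed.

Definition dual_code (chi : dual) : {ffun gT -> 'I_(size unity_roots).+1} :=
  [ffun x => inord (index (chi x) unity_roots)].

Definition dual_decode (c : {ffun gT -> 'I_(size unity_roots).+1}) :
  option dual := insub [ffun x => nth 0 unity_roots (c x)].

Lemma dual_codeK : pcancel dual_code dual_decode.
Proof.
move=> chi; rewrite /dual_decode.
suff -> : [ffun x => nth 0 unity_roots (dual_code chi x)] = val chi by rewrite valK.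
apply/ffunP=> x; rewrite !ffunE inordK ?nth_index ?dual_unity_root //.
by rewrite ltnS index_size.
Qed.

HB.instance Definition _ := 
  Choice_isCountable.Build dual (pcan_pickleK dual_codeK).
HB.instance Definition _ := isFinite.Build dual (pcan_enumP dual_codeK).

Lemma dual_one_subproof : is_char [ffun=> 1].
Proof.
by apply/is_charP; split=> [x|x y]; rewrite !ffunE ?oner_eq0 ?mulr1.
Qed.

Lemma dual_mul_subproof (chi psi : dual) : is_char [ffun x => chi x * psi x].
Proof.
apply/is_charP; split=> [x|x y]; rewrite !ffunE ?mulf_neq0 ?dual_neq0 //.
by rewrite !dualM mulrACA.
Qed.

Lemma dual_inv_subproof (chi : dual) : is_char [ffun x => (chi x)^-1].
Proof.
apply/is_charP; split=> [x|x y]; rewrite !ffunE ?invr_eq0 ?dual_neq0 //.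
by rewrite dualM invfM.
Qed.

Definition dual_one := Dual dual_one_subproof.
Definition dual_mul chi psi := Dual (dual_mul_subproof chi psi).
Definition dual_inv chi := Dual (dual_inv_subproof chi).

Lemma dual_mulA : associative dual_mul.
Proof. by move=> a b c; apply/val_inj/ffunP=> x; rewrite !ffunE mulrA. Qed.

Lemma dual_mul1 : left_id dual_one dual_mul.
Proof. by move=> a; apply/val_inj/ffunP=> x; rewrite !ffunE mul1r. Qed.

Lemma dual_mulV : left_inverse dual_one dual_inv dual_mul.
Proof.
by move=> a; apply/val_inj/ffunP=> x; rewrite !ffunE mulVf ?dual_neq0.
Qed.

HB.instance Definition _ :=
  Finite_isGroup.Build dual dual_mulA dual_mul1 dual_mulV.

Definition annihilator (H : {set gT}) : {set dual} :=
  [set chi : dual | [forall h in H, chi h == 1]].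

Lemma annihilator_group_set (H : {set gT}) : group_set (annihilator H).
Proof.
apply/group_setP; split=> [|a b]; rewrite !inE.
  by apply/forall_inP=> h _; rewrite ffunE.
move=> /forall_inP Ha /forall_inP Hb; apply/forall_inP=> h hH.
by rewrite ffunE (eqP (Ha _ hH)) (eqP (Hb _ hH)) mulr1.
Qed.

Canonical annihilator_group H := Group (annihilator_group_set H).

End Dual.

Arguments dual C gT : clear implicits.
Arguments annihilator C {gT} H.

(* Main.v *)
Require Import Defs.
From HB Require Import structures.
From mathcomp Require Import all_boot all_order all_algebra all_fingroup.
From mathcomp Require Import complex mpoly reals.
From mathcomp Require Import center pgroup mxrepresentation.

(** Everything follows from Dedekind's factorization of the group determinant of
    a finite abelian group K: multiplying the matrix (w (g h^-1)) on the left by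
    the character table P of K scales row chi of P by the eigenvalue
    sum_g chi(g) w(g), and P is invertible by orthogonality, so the determinant
    is the product of these eigenvalues over all characters chi of K
    ([group_det_char_family]).

    For the first equality, factor Theta_G over the characters of G, and write
    each character uniquely as chi * psi with chi in X and psi trivial on H.
    For fixed chi, psi runs over the characters of G / H, and the eigenvalue
    sum_g chi(g) psi(g) x_g, summed coset by coset, is the eigenvalue
    sum_(tH) psi(tH) y^chi_(tH) of the matrix of Theta_(G/H)(y^chi); the product
    over psi is therefore Theta_(G/H)(y^chi) ([group_det_prod_quotient]).

    For the second, restriction to H maps X bijectively onto the characters of
    H. The z_h are the inverse Fourier transform on H of the function
    chi |-> Theta_(G/H)(y^chi), so by orthogonality the eigenvalue of the matrix
    of Theta_H(z) at chi is Theta_(G/H)(y^chi) ([prod_eq_group_det]).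

    Dedekind's factorization needs as many characters as group elements. For G
    this comes from the irreducible representations of an abelian group over an
    algebraically closed field of characteristic 0 ([card_dual_ge]). For H and
    G / H it comes from counting: independence of characters bounds the size of
    X by that of H and the size of the annihilator of H by that of G / H, while
    the two products of sizes both equal the order of G, so both bounds are
    attained ([card_transversal_annihilator]). *)

Set Implicit Arguments.
Unset Strict Implicit.
Unset Printing Implicit Defensive.

Import GRing.Theory.
Local Open Scope ring_scope.
Local Open Scope complex_scope.

(** * Sums over a transversal of the cosets of a subgroup *)

Section Transversals.
Variables (gT : finGroupType) (G H : {group gT}) (T : {set gT}).
Hypotheses (sHG : H \subset G) (T_repr : is_transversal T (lcosets H G) G).

Lemma transversal_lcoset_repr x :
  x \in G -> exists2 t, t \in T & x \in (t *: H)%g.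
Proof.
have defT := T_repr; case/and3P: defT => partG sTG /forall_inP T1 Gx.
have /T1/cards1P[t Dt] : (x *: H)%g \in lcosets H G by apply/lcosetsP; exists x.
have /setIP[Tt xHt] : t \in T :&: (x *: H)%g by rewrite Dt set11.
by exists t; rewrite // lcoset_sym.
Qed.

Lemma transversal_lcoset_inj t u :
  t \in T -> u \in T -> t \in (u *: H)%g -> t = u.
Proof.
have defT := T_repr; case/and3P: defT => partG sTG /forall_inP T1 Tt Tu tuH.
have /T1/cards1P[v Dv] : (u *: H)%g \in lcosets H G.
  by apply/lcosetsP; exists u; rewrite ?(subsetP sTG).
have /set1P-> : t \in [set v] by rewrite -Dv inE Tt.
suffices /set1P-> : u \in [set v] by [].
by rewrite -Dv inE Tu lcoset_refl.
Qed.

Lemma big_transversal_lcosets (R : Type) (idx : R) (op : Monoid.com_law idx)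
    (F : gT -> R) :
  \big[op/idx]_(x in G) F x
    = \big[op/idx]_(t in T) \big[op/idx]_(h in H) F (t * h)%g.
Proof.
(* Group the terms by the representative in T of the coset of x; the default
   1 is never taken for x in G, by transversal_lcoset_repr. *)
pose rep x := odflt 1%g [pick t in T | x \in (t *: H)%g].
have repP x t : x \in G -> t \in T -> (rep x == t) = (x \in (t *: H)%g).
  move=> Gx Tt; rewrite /rep; case: pickP => [u /andP[Tu xuH] | noT] /=.
    apply/eqP/idP => [<- // | xtH]; apply: transversal_lcoset_inj => //.
    by rewrite -(lcoset_eqP xtH) lcoset_sym.
  have [u Tu xuH] := transversal_lcoset_repr Gx.
  by have := noT u; rewrite Tu xuH.
have Trep x : x \in G -> rep x \in T.
  move=> Gx; have [u Tu xuH] := transversal_lcoset_repr Gx.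
  by have /eqP-> : rep x == u by rewrite repP.
rewrite (partition_big rep (mem T)) //=; apply: eq_bigr => t Tt.
have Gt : t \in G by apply: subsetP Tt; apply: transversal_sub T_repr.
rewrite (reindex_inj (mulgI t)); apply: eq_bigl => h /=.
rewrite groupMl //; apply/andP/idP => [[Gh] | Hh].
  by rewrite repP ?groupM // mem_lcoset mulKg.
by have Gh := subsetP sHG h Hh; rewrite Gh repP ?groupM // mem_lcoset mulKg.
Qed.

(** Normality makes the left cosets that T represents the elements of G / H, so
    that T and G / H are in bijection. *)
Lemma big_transversal_quotient (R : Type) (idx : R) (op : Monoid.com_law idx)
    (F : coset_of H -> R) : G \subset 'N(H)%g ->
  \big[op/idx]_(u in (G / H)%g) F u = \big[op/idx]_(t in T) F (coset H t).
Proof.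
move=> nHG; have sTG := transversal_sub T_repr.
have nHT t : t \in T -> t \in 'N(H)%g.
  by move=> Tt; rewrite !(subsetP nHG, subsetP sTG).
have -> : (G / H = [set coset H t | t in T])%g.
  apply/setP=> u; apply/morphimP/imsetP=> [[x Nx Gx ->] | [t Tt ->]].
    have [t Tt xtH] := transversal_lcoset_repr Gx; exists t => //=.
    apply/(rcoset_kercosetP Nx (nHT t Tt)).
    by rewrite norm_rlcoset ?nHT.
  by exists t; rewrite ?nHT ?(subsetP sTG).
rewrite big_imset // => t u Tt Tu /= /(rcoset_kercosetP (nHT t Tt) (nHT u Tu)).
by rewrite norm_rlcoset ?nHT //; apply: transversal_lcoset_inj.
Qed.

Lemma card_transversal_lcosets : (#|T| * #|H| = #|G|)%N.
Proof. by rewrite (card_transversal T_repr) card_lcosets mulnC Lagrange. Qed.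

End Transversals.

(** * Existence of enough characters *)

(** Over an algebraically closed field of characteristic 0 a finite group has as
    many irreducible representations as conjugacy classes. For an abelian group
    there is one class per element, and each irreducible representation has
    degree 1, hence is determined by the character through which it acts. *)
Lemma card_dual_ge (C : numClosedFieldType) (gT : finGroupType) :
  abelian [set: gT] -> (#|gT| <= #|{: dual C gT}|)%N.
Proof.
move=> cGG; set G := [set: gT]%G.
have splitG : group_splitting_field C G by apply: group_closure_closed_field.
have C'G : pgroup [pchar C]^' G.
  by apply/pgroupP=> p _ _; rewrite inE /= Num.Theory.pchar_num.
have sG : irrType C G by apply: DecSocleType.
have ZG x : x \in 'Z(G)%g by rewrite (center_idP _) ?inE.
have mode_char (i : sG) : is_char [ffun x => irr_mode i x].
  apply/is_charP; split=> [x | x y]; rewrite !ffunE.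
    exact: irr_mode_neq0.
  exact: irr_modeM.
pose f i := Dual (mode_char i).
rewrite -cardsT; have := cGG; rewrite card_classes_abelian => /eqP <-.
rewrite -(card_irr_pchar sG C'G splitG).
apply: (leq_card f) => i j /(congr1 (fun chi : dual C gT => chi : gT -> C)).
move=> eq_ij; apply/eqP/socle_rsimP.
have eq_n : irr_degree i = irr_degree j.
  by rewrite !(irr_degree_abelian splitG cGG).
(* Both representations act by the same scalars, so any invertible matrix
   intertwines them. The degrees are equal but not convertible: pid_mx is an
   identity matrix that needs no cast between them. *)
apply: (@MxReprSim _ _ _ _ _ _ _ (pid_mx (irr_degree i))) => // [|x Gx].
  by rewrite /row_free rank_pid_mx // eq_n.
have := congr1 (fun g => g x) eq_ij; rewrite /= !ffunE => eq_x.
rewrite -/(irr_repr i) -/(irr_repr j).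
by rewrite !(irr_center_scalar splitG) // eq_x scalar_mxC.
Qed.

(** * Families of characters and Dedekind's factorization *)

Section CharFamily.
Variables (C : numFieldType) (gT : finGroupType) (K : {group gT}).

(** Characters of K are kept as functions on the ambient type, constrained on K
    only, so that a character of G is also one of its subgroups. *)
Definition is_char_on (f : gT -> C) :=
  {in K, forall x, f x != 0} /\ {in K &, {morph f : x y / (x * y)%g >-> x * y}}.

Variables (I : finType) (X : {set I}) (e : I -> gT -> C).

Definition char_family :=
  {in X, forall i, is_char_on (e i)} /\
  {in X &, forall i j, {in K, e i =1 e j} -> i = j}.

Hypothesis eX : char_family.

(** For distinct e i and e j, the sum S is multiplied by e i y / e j y when its
    index is translated by y; where that ratio is not 1, this forces S = 0. *)
Lemma char_family_orthogonal : {in X &, forall i j,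
  \sum_(x in K) e i x * e j x^-1%g = #|K|%:R *+ (i == j)}.
Proof.
case: eX => eM e_inj i j Xi Xj; have [_ eiM] := eM i Xi.
have [ej0 ejM] := eM j Xj.
have ej1 : e j 1%g = 1.
  by apply: (mulfI (ej0 1%g (group1 K))); rewrite -ejM ?mulg1 ?mulr1.
have ejV x : x \in K -> e j x * e j x^-1%g = 1.
  by move=> Kx; rewrite -ejM ?groupV // mulgV ej1.
have [-> | ne_ij] := eqVneq i j; first by rewrite (eq_bigr _ ejV) sumr_const.
have /existsP[y /andP[Ky ne_y]] : [exists y, (y \in K) && (e i y != e j y)].
  apply: contraNT ne_ij; rewrite negb_exists => /forallP eq_ij; apply/eqP.
  by apply: e_inj => // y Ky; have:= eq_ij y; rewrite Ky negbK => /eqP.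
set S := \sum_(x in K) _; rewrite mulr0n; apply/eqP.
have /eqP : e i y * S = e j y * S.
  rewrite mulr_sumr {1}/S [X in _ = _ * X](reindex_inj (mulgI y)) mulr_sumr /=.
  apply: eq_big => x; first by rewrite groupMl.
  move=> Kx; rewrite eiM // invMg ejM ?groupV //.
  rewrite (mulrCA (e j y)) [e j x^-1%g * _]mulrC (mulrA (e j y)) ejV //.
  by rewrite mul1r mulrA.
by rewrite -subr_eq0 -mulrBl mulf_eq0 subr_eq0 (negPf ne_y).
Qed.

Let natK_neq0 : #|K|%:R != 0 :> C.
Proof. by rewrite Num.Theory.pnatr_eq0 -lt0n cardG_gt0. Qed.

(** Orthogonality gives the character table, with #|X| rows and #|K| columns, a
    right inverse, so its rows are independent. *)
Lemma char_family_card_le : (#|X| <= #|K|)%N.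
Proof.
pose P := \matrix_(i < #|X|, k < #|K|) e (enum_val i) (enum_val k).
pose Q := \matrix_(k < #|K|, j < #|X|) e (enum_val j) (enum_val k)^-1%g.
suffices P_free : row_free P by rewrite -(eqP P_free) rank_leq_col.
apply/row_freeP; exists (#|K|%:R^-1 *: Q); rewrite -scalemxAr.
apply/matrixP=> i j; rewrite !mxE.
under eq_bigr do rewrite !mxE.
rewrite -(big_enum_val (fun x => e (enum_val i) x * e (enum_val j) x^-1%g)) /=.
rewrite char_family_orthogonal ?enum_valP // (inj_eq enum_val_inj).
by rewrite mulrnAr mulVf.
Qed.

(** Dedekind's factorization, for a complete family of characters. The
    conclusion lives in an algebra A over C that may have zero divisors: the
    determinant of the character table is a nonzero scalar of C, hence can be
    cancelled. *)
Lemma group_det_char_family (A : comAlgType C) (w : gT -> A) :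
  #|X| = #|K| ->
  group_det K w = \prod_(i in X) \sum_(x in K) e i x *: w x.
Proof.
move=> cardX; pose xi (i : 'I_#|K|) : I := enum_val (cast_ord (esym cardX) i).
have Xxi i : xi i \in X by apply: enum_valP.
have xi_inj : injective xi by move=> i j /enum_val_inj/cast_ord_inj.
pose eig i := \sum_(x in K) e i x *: w x.
pose P := \matrix_(i < #|K|, k < #|K|) e (xi i) (enum_val k).
pose Q := \matrix_(k < #|K|, j < #|K|) e (xi j) (enum_val k)^-1%g.
have detP_neq0 : \det P != 0.
  have : P *m Q = #|K|%:R%:M.
    apply/matrixP=> i j; rewrite !mxE.
    under eq_bigr do rewrite !mxE.
    rewrite -(big_enum_val (fun x => e (xi i) x * e (xi j) x^-1%g)) /=.
    by rewrite char_family_orthogonal // (inj_eq xi_inj).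
  move/(congr1 determinant); rewrite det_mulmx det_scalar => detPQ.
  have := expf_neq0 #|K| natK_neq0; rewrite -detPQ mulf_eq0 negb_or.
  by case/andP.
pose PA := map_mx (in_alg A) P.
pose M := \matrix_(i < #|K|, j < #|K|) w (enum_val i * (enum_val j)^-1)%g.
(* The row of PA at the character e i is a left eigenvector of M, as is seen by
   the change of index x := k h in the sum of e i x *: w (x h^-1). *)
have PM : PA *m M = diag_mx (\row_i eig (xi i)) *m PA.
  apply/matrixP=> i j; rewrite mul_diag_mx !mxE.
  under eq_bigr do rewrite !mxE mulr_algl.
  set h := enum_val j; have Kh : h \in K by apply: enum_valP.
  rewrite -(big_enum_val (fun x => e (xi i) x *: w (x * h^-1)%g)) /=.
  rewrite (reindex_inj (mulIg h)) mulr_algr scaler_sumr /=.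
  apply: eq_big => x; first by rewrite groupMr.
  rewrite groupMr // => Kx; have [_ /(_ x h Kx Kh)->] := eX.1 _ (Xxi i).
  by rewrite mulgK scalerA mulrC.
have /eqP : \det P *: \det M = \det P *: \prod_i eig (xi i).
  move/(congr1 determinant): PM; rewrite !det_mulmx det_diag det_map_mx.
  rewrite mulr_algl mulr_algr => ->; congr (_ *: _).
  by apply: eq_bigr => i _; rewrite mxE.
rewrite -subr_eq0 -scalerBr scaler_eq0 (negPf detP_neq0) subr_eq0 => /eqP.
rewrite /group_det -/M => ->.
rewrite [RHS]big_enum_val /= (reindex (cast_ord (esym cardX))) //.
by exists (cast_ord cardX) => i _; rewrite ?cast_ordK ?cast_ordKV.
Qed.

End CharFamily.

(** * The characters of G, H and G / H *)

Section DualFamilies.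
Variables (C : numClosedFieldType) (gT : finGroupType) (H : {group gT}).
Variable X : {set dual C gT}.
Hypothesis cGG : abelian [set: gT].
Hypothesis X_repr :
  is_transversal X (lcosets (annihilator C H) [set: dual C gT]) [set: dual C gT].

Lemma dual_is_char_on (K : {group gT}) (chi : dual C gT) : is_char_on K chi.
Proof. by split=> [x _ | x y _ _]; [apply: dual_neq0 | apply: dualM]. Qed.

Lemma dual_family :
  char_family [set: gT]%G [set: dual C gT] (fun chi : dual C gT => chi).
Proof.
split=> [chi _ | chi psi _ _ eq_chi]; first exact: dual_is_char_on.
by apply/val_inj/ffunP=> x; apply: eq_chi; rewrite inE.
Qed.

Lemma card_dual : #|[set: dual C gT]| = #|[set: gT]|.
Proof.
apply/eqP; rewrite eqn_leq (char_family_card_le dual_family) /=.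
by rewrite !cardsT card_dual_ge.
Qed.

(** Two characters of G that agree on H lie in the same coset of the annihilator
    of H, and X meets each coset once. *)
Lemma transversal_family : char_family H X (fun chi : dual C gT => chi).
Proof.
split=> [chi _ | chi psi Xchi Xpsi eq_chi]; first exact: dual_is_char_on.
apply: (transversal_lcoset_inj X_repr) => //; rewrite mem_lcoset.
rewrite inE; apply/forall_inP=> h Hh.
by rewrite !ffunE eq_chi // mulVf ?dual_neq0.
Qed.

Lemma annihilatorP (chi : dual C gT) :
  reflect {in H, forall h, chi h = 1} (chi \in annihilator C H).
Proof.
by rewrite inE; apply: (iffP forall_inP) => chiH h /chiH => [/eqP | ->].
Qed.

Lemma annihilator_repr (chi : dual C gT) x :
  chi \in annihilator C H -> x \in 'N(H)%g -> chi (repr (coset H x)) = chi x.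
Proof.
move=> /annihilatorP chiH Nx; rewrite val_coset //.
have /rcosetP[h Hh ->] := mem_repr_rcoset H x.
by rewrite dualM chiH ?mul1r.
Qed.

Let nHG : [set: gT] \subset 'N(H)%g.
Proof. by rewrite sub_abelian_norm ?subsetT. Qed.

(** A character that is trivial on H is evaluated at a coset through an arbitrary
    representative. *)
Lemma annihilator_family :
  char_family ([set: gT] / H)%G (annihilator C H)
    (fun (psi : dual C gT) u => psi (repr u)).
Proof.
split=> [psi psiH | psi phi psiH phiH eq_psi].
  split=> [u _ | _ _ /morphimP[x Nx _ ->] /morphimP[y Ny _ ->]].
    exact: dual_neq0.
  by rewrite -morphM // !annihilator_repr ?groupM // dualM.
apply/val_inj/ffunP=> x; have Nx : x \in 'N(H)%g by rewrite (subsetP nHG) ?inE.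
rewrite -[LHS](annihilator_repr psiH Nx) -[RHS](annihilator_repr phiH Nx).
by apply: eq_psi; apply: mem_quotient; rewrite inE.
Qed.

(** Independence of characters gives #|X| <= #|H| and
    #|annihilator C H| <= #|G / H|; both are equalities because
    #|X| * #|annihilator C H| = #|G| = #|H| * #|G / H|. *)
Lemma card_transversal_annihilator :
  #|X| = #|H| /\ #|annihilator C H| = #|([set: gT] / H)%g|.
Proof.
have leX := char_family_card_le transversal_family.
have leA := char_family_card_le annihilator_family.
have := card_transversal_lcosets (G := [set: dual C gT]%G)
  (H := annihilator_group C H) (subsetT _) X_repr.
rewrite /= card_dual -(Lagrange (subsetT H)) -card_quotient // => eq_mul.
have A_gt0 := cardG_gt0 (annihilator_group C H).
have H_gt0 := cardG_gt0 H.
have eqX : #|X| = #|H|.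
  apply/eqP; rewrite eqn_leq leX -(leq_pmul2r A_gt0) eq_mul.
  by rewrite leq_pmul2l.
by split=> //; apply/eqP; rewrite -(eqn_pmul2l H_gt0) -eq_mul eqX.
Qed.

End DualFamilies.

(** * The two factorizations *)

Section Factorization.
Variables (C : numClosedFieldType) (A : comAlgType C) (gT : finGroupType).
Variables (H : {group gT}) (T : {set gT}) (X : {set dual C gT}).
Variables (x : gT -> A) (y : dual C gT -> coset_of H -> A) (z : gT -> A).
Hypotheses (cGG : abelian [set: gT])
  (T_repr : is_transversal T (lcosets H [set: gT]) [set: gT])
  (X_repr : is_transversal X
     (lcosets (annihilator C H) [set: dual C gT]) [set: dual C gT]).

(** Both sides are products, over chi in X and psi in the annihilator of H, of
    sum_g (chi psi)(g) x_g: the left one because the products chi * psi exhaust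
    the characters of G, the right one because psi (t h) = psi t. *)
Lemma group_det_prod_quotient :
    (forall chi t, chi \in X -> t \in T ->
       y chi (coset H t) = \sum_(h in H) chi (t * h)%g *: x (t * h)%g) ->
  group_det [set: gT] x = \prod_(chi in X) group_det ([set: gT] / H) (y chi).
Proof.
move=> y_def; have [_ cardA] := card_transversal_annihilator cGG X_repr.
have nHG : [set: gT] \subset 'N(H)%g by rewrite sub_abelian_norm ?subsetT.
rewrite (group_det_char_family (dual_family _ _)) ?card_dual //.
rewrite (big_transversal_lcosets (G := [set: dual C gT]%G)
  (H := annihilator_group C H) (subsetT _) X_repr) /=.
apply: eq_bigr => chi Xchi.
rewrite (group_det_char_family (annihilator_family _ _ cGG)) //.
apply: eq_bigr => psi psiH.
rewrite (big_transversal_lcosets (G := [set: gT]%G) (subsetT H) T_repr) /=.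
rewrite (big_transversal_quotient (G := [set: gT]%G) T_repr) //=.
apply: eq_bigr => t Tt; rewrite y_def // scaler_sumr.
rewrite annihilator_repr ?(subsetP nHG) ?in_setT //.
apply: eq_bigr => h Hh; rewrite scalerA ffunE (dualM psi).
by rewrite (elimT (annihilatorP _ _) psiH h Hh) mulr1 mulrC.
Qed.

(** Fourier inversion on H: when z is the inverse transform of an arbitrary
    function theta on X, the eigenvalues of the matrix of Theta_H(z) are the
    values of theta. *)
Lemma prod_eq_group_det (theta : dual C gT -> A) :
    (forall h, h \in H ->
       z h = #|H|%:R^-1 *: \sum_(chi in X) chi h^-1%g *: theta chi) ->
  \prod_(chi in X) theta chi = group_det H z.
Proof.
move=> z_def; have [cardX _] := card_transversal_annihilator cGG X_repr.
rewrite (group_det_char_family (transversal_family X_repr)) //.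
apply: eq_bigr => chi Xchi.
have H_neq0 : #|H|%:R != 0 :> C by rewrite Num.Theory.pnatr_eq0 -lt0n cardG_gt0.
under eq_bigr => h Hh do rewrite z_def // scalerA mulrC -scalerA scaler_sumr.
rewrite -scaler_sumr exchange_big /=.
under eq_bigr => psi Xpsi.
  under eq_bigr do rewrite scalerA.
  rewrite -scaler_suml (char_family_orthogonal (transversal_family X_repr)) //.
  over.
rewrite (bigD1 chi) //= eqxx mulr1n big1 ?addr0 => [|psi /andP[_ /negPf ne]].
  by rewrite scalerA mulVf // scale1r.
by rewrite eq_sym ne mulr0n scale0r.
Qed.

End Factorization.

Theorem theorem1p1 (R : realType) (gT : finGroupType) (H : {group gT})
    (T : {set gT}) (X : {set dual R[i] gT})
    (y : dual R[i] gT -> coset_of H -> {mpoly R[i][#|gT|]})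
    (z : gT -> {mpoly R[i][#|gT|]})
    (G_abelian : abelian [set: gT])
    (T_repr : is_transversal T (lcosets H [set: gT]) [set: gT])
    (X_repr : is_transversal X
                (lcosets (annihilator R[i] H) [set: dual R[i] gT])
                [set: dual R[i] gT])
    (y_def : forall chi t, chi \in X -> t \in T ->
       y chi (coset H t) =
         \sum_(h in H) chi (t * h)%g *: group_var R[i] (t * h)%g)
    (z_def : forall h, h \in H ->
       z h = #|H|%:R^-1 *:
               \sum_(chi in X) chi h^-1%g *: group_det ([set: gT] / H) (y chi)) :
  map_mpoly intr (group_det [set: gT] (group_var int)) =
    \prod_(chi in X) group_det ([set: gT] / H) (y chi)
  /\ \prod_(chi in X) group_det ([set: gT] / H) (y chi) = group_det H z.
Proof.
split; last exact: (prod_eq_group_det G_abelian X_repr z_def).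
(* What remains is that group determinants commute with Z -> R[i]. *)
rewrite -(group_det_prod_quotient G_abelian T_repr X_repr y_def).
rewrite /group_det -det_map_mx; congr (\det _).
by apply/matrixP=> i j; rewrite !mxE /group_var /= map_mpolyX.
Qed.
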